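(* Let $G$ be an Abelian group, and let $l,N$ be positive integers with $l\ge2$. If the functions $\varphi_0,\varphi_1,\ldots,\varphi_N\colon G\to\mathbb{C}$ form a moment sequence of order $N$, then $$\varphi_n(x_1+x_2+\cdots+x_l)=\sum_{\substack{k_1,k_2,\ldots,k_l\ge0\\ k_1+k_2+\cdots+k_l=n}}\binom{n}{k_1,k_2,\ldots,k_l}\prod_{t=1}^{l}\varphi_{k_t}(x_t)$$ holds for all $x_1,x_2,\ldots,x_l\in G$ and $n=0,1,\ldots,N$.
   Context: The group is written additively. For nonnegative integers $k_1,\ldots,k_l$ with $k_1+\cdots+k_l=n$, $\binom{n}{k_1,\ldots,k_l}=\frac{n!}{k_1!\cdots k_l!}$ is the multinomial coefficient. Functions $\varphi_0,\ldots,\varphi_N\colon G\to\mathbb{C}$ form a moment sequence of order $N$ if $\varphi_0=1$ (the constant function $1$) and $$\varphi_k(x+y)=\sum_{j=0}^{k}\binom{k}{j}\varphi_j(x)\varphi_{k-j}(y)$$ for all $x,y\in G$ and $k=0,1,\ldots,N$. *)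

(* Defs.v *)
From mathcomp Require Export all_boot all_order all_algebra.
From mathcomp Require Export reals complex.

Set Implicit Arguments.
Unset Strict Implicit.
Unset Printing Implicit Defensive.

Import GRing.Theory.
Local Open Scope ring_scope.

(* The family is indexed by nat; only its members phi 0, ..., phi N are
   constrained. *)
Definition moment_sequence (R : realType) (G : zmodType) (N : nat)
    (phi : nat -> G -> R[i]) : Prop :=
  (forall x : G, phi 0%N x = 1) /\
  (forall (k : nat) (x y : G), (k <= N)%N ->
     phi k (x + y) =
       \sum_(0 <= j < k.+1) 'C(k, j)%:R * phi j x * phi (k - j)%N y).

Definition multinomial (F : fieldType) (n l : nat) (k : 'I_l -> nat) : F :=
  n`!%:R / \prod_(t < l) (k t)`!%:R.
Arguments multinomial F n {l} k.

(* Main.v *)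
(* With f_k = phi_k / k!, the moment relations say that the generating
   polynomial x |-> \sum_(k <= n) f_k(x) 'X^k turns sums in G into products
   modulo 'X^n.+1.  The formula is the coefficient of 'X^n in the product of
   the generating polynomials of the x_t. *)
Require Import Defs.

Import GRing.Theory Num.Theory.
Local Open Scope ring_scope.

(** Distributing the product gives one monomial per choice [k] of exponents, its degree being their
    sum; only those of degree [n] contribute. *)
Lemma coef_prod_poly (S : comNzRingType) (l n : nat) (a : 'I_l -> nat -> S) :
  (\prod_(t < l) \poly_(i < n.+1) a t i)`_n =
    \sum_(k : {ffun 'I_l -> 'I_n.+1} | (\sum_(t < l) k t)%N == n)
       \prod_(t < l) a t (k t).
Proof.
under eq_bigr do rewrite poly_def.
rewrite bigA_distr_bigA coef_sum [RHS]big_mkcond; apply: eq_bigr => k _.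
by rewrite scaler_prod prodrXr coefZ coefXn eq_sym mulr_natr; case: eqP.
Qed.

Lemma natf_bin_fact (F : numFieldType) (m j : nat) : (j <= m)%N ->
  'C(m, j)%:R / m`!%:R = j`!%:R^-1 * (m - j)`!%:R^-1 :> F.
Proof.
move=> le_jm; rewrite -(bin_fact le_jm) 2!natrM 2!invfM mulVKf //.
by rewrite pnatr_eq0 -lt0n bin_gt0.
Qed.

Section MomentSequence.
Variables (R : realType) (G : zmodType) (N : nat) (phi : nat -> G -> R[i]).
Hypothesis phi_moment : moment_sequence N phi.

Lemma moment_sequence0 (k : nat) : (k <= N)%N -> phi k 0 = (k == 0%N)%:R.
Proof.
have [phi0 phiD] := phi_moment.
elim/ltn_ind: k => -[|k] IH le_kN; first exact: phi0.
(* At [x = y = 0] the inner terms vanish by induction and both end terms are [phi k.+1 0], so this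
   value equals its double. *)
have := phiD k.+1 0 0 le_kN.
rewrite addr0 big_nat_recl // big_nat_recr //= big_nat big1 => [|j lt_jk].
  rewrite bin0 binn subn0 subnn !phi0 !mul1r mulr1 add0r => /eqP.
  by rewrite -[X in X == _]addr0 (inj_eq (addrI _)) eq_sym => /eqP.
by rewrite IH ?ltnS // ?(leq_trans _ le_kN) ?mulr0 ?mul0r // ltnS ltnW.
Qed.

(** All [m <= n] are treated together because a coefficient of a product is a convolution of all
    coefficients up to that degree. *)
Lemma coef_prod_moment_poly (n l : nat) (x : 'I_l -> G) : (n <= N)%N ->
  forall m, (m <= n)%N ->
  (\prod_(t < l) \poly_(i < n.+1) (phi i (x t) / i`!%:R))`_m =
    phi m (\sum_(t < l) x t) / m`!%:R.
Proof.
move=> le_nN; have [_ phiD] := phi_moment.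
pose K (p : {poly R[i]}) g :=
  forall m, (m <= n)%N -> p`_m = phi m g / m`!%:R.
apply: (big_ind2 K) => [m le_mn | p g q h pg qh m le_mn | t _ m le_mn].
- rewrite moment_sequence0 ?(leq_trans le_mn) // coef1.
  by case: m le_mn => [|m] _; rewrite ?mul0r // divr1.
- have le_mN := leq_trans le_mn le_nN.
  rewrite coefM phiD // big_mkord mulr_suml; apply: eq_bigr => j _.
  have le_jm : (j <= m)%N by rewrite -ltnS.
  rewrite pg ?qh ?(leq_trans _ le_mn) ?leq_subr //.
  by rewrite mulrACA -natf_bin_fact // mulrC -(mulrA 'C(m, j)%:R) [RHS]mulrAC.
- by rewrite coef_poly ltnS le_mn.
Qed.

End MomentSequence.

(* Entries of k are bounded by n in its type; this loses no index, since
   nonnegative integers summing to n are all at most n. *)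
Theorem proposition2 (R : realType) (G : zmodType) (l N : nat)
    (hl : (2 <= l)%N) (hN : (1 <= N)%N)
    (phi : nat -> G -> R[i]) (hphi : moment_sequence N phi)
    (n : nat) (hn : (n <= N)%N) (x : 'I_l -> G) :
  phi n (\sum_(t < l) x t) =
    \sum_(k : {ffun 'I_l -> 'I_n.+1} | (\sum_(t < l) k t)%N == n)
       multinomial R[i] n (fun t => k t) * \prod_(t < l) phi (k t) (x t).
Proof.
have nfact_neq0 : n`!%:R != 0 :> R[i] by rewrite pnatr_eq0 -lt0n fact_gt0.
have := coef_prod_moment_poly _ _ _ _ hphi _ _ x hn n (leqnn n).
rewrite (coef_prod_poly _ _ _ (fun t i => phi i (x t) / i`!%:R)).
(* Multiplying the coefficient by n! turns the inverse factorials into multinomials. *)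
move=> coef_n; rewrite -[LHS](divfK nfact_neq0) -coef_n.
rewrite mulr_suml; apply: eq_bigr => k _.
rewrite /multinomial big_split prodfV /=.
by rewrite [RHS]mulrAC -mulrA mulrC.
Qed.
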